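(* Steenrod's cup-$i$ construction $\triangle^{\mathrm S}$ agrees with the canonical cup-$i$ construction $\triangle^{\mathrm{cn}}$; that is, $\triangle^{\mathrm S}_i[n]=\triangle^{\mathrm{cn}}_i[n]$ in $N(\Delta^n)^{\otimes 2}$ for all $i,n\in\mathbb{N}$.
   Context: $N(\Delta^n)$ is the chain complex over $\mathbb{F}_2$ with basis the faces (non-empty subsets of $\{0,\dots,n\}$) of the standard $n$-simplex $\Delta^n$; a face with vertices $v_0<\dots<v_m$ is written $[v_0,\dots,v_m]$, and $[n]$ denotes the top-dimensional face. A semi-simplicial cup-$i$ construction is encoded by elements $\triangle_i[n]\in N(\Delta^n)^{\otimes 2}_{n+i}$, $i,n\in\mathbb{N}$, such that the induced maps $\triangle_i\colon N(\Delta^n)\to N(\Delta^n)^{\otimes2}$, natural with respect to coface maps, satisfy $\partial\triangle_i+\triangle_i\partial=(1+T)\triangle_{i-1}$, where $T$ is transposition of tensor factors and $\triangle_{-1}=0$. **Canonical construction.** For $U\subsetneq\{0,\dots,n\}$ let $d_U[n]$ be the face of $\Delta^n$ with vertex set $\{0,\dots,n\}\setminus U$. For $U=\{u_1<\dots<u_{n-i}\}$ and $\varepsilon\in\{0,1\}$ let $U^\varepsilon=\{u_j\in U: u_j+j\equiv \varepsilon \bmod 2\}$. Then $\triangle^{\mathrm{cn}}_i[n]=\sum_{U\subseteq\{0,\dots,n\},\,|U|=n-i} d_{U^0}[n]\otimes d_{U^1}[n]$ for $0\le i\le n$ and $\triangle^{\mathrm{cn}}_i[n]=0$ for $i>n$.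 **Steenrod's construction.** If $i>n$ then $\triangle^{\mathrm S}_i[n]=0$. Otherwise $\triangle_i^{\mathrm S}[n]$ is the sum over all sequences of integers $0\le p_1<\dots<p_{i+1}\le n$ of $$[0,\dots,p_1]\ast[p_2,\dots,p_3]\ast\dots\ast[p_{i+1},\dots,n]\ \otimes\ [p_1,\dots,p_2]\ast\dots\ast[p_i,\dots,p_{i+1}]$$ if $i$ is odd, and of $$[0,\dots,p_1]\ast[p_2,\dots,p_3]\ast\dots\ast[p_i,\dots,p_{i+1}]\ \otimes\ [p_1,\dots,p_2]\ast[p_3,\dots,p_4]\ast\dots\ast[p_{i+1},\dots,n]$$ if $i$ is even. Here $[a,\dots,b]$ denotes the face with vertices all integers from $a$ to $b$, and $\ast$ is the join of simplices, i.e. the face whose vertex set is the union of those of the joined faces (in the formulas these are pairwise disjoint). *)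

(* Defs.v *)
From mathcomp Require Import all_boot all_algebra.

Set Implicit Arguments.
Unset Strict Implicit.
Unset Printing Implicit Defensive.

Import GRing.Theory.
Local Open Scope ring_scope.

Definition face (n : nat) : finType := {A : {set 'I_n.+1} | A != set0}.

(* The F_2-vector spaces underlying N(Delta^n) and its tensor square, as
   coordinate functions on their bases: faces, and ordered pairs of faces (the
   pair (a, b) standing for a (x) b). *)
Notation chain n := {ffun face n -> 'F_2}.
Notation chain2 n := {ffun face n * face n -> 'F_2}.

(* The basis element with vertex set A; by convention 0 when A is empty, which
   never happens in the sums below. *)
Definition simplex n (A : {set 'I_n.+1}) : chain n :=
  [ffun s : face n => (val s == A)%:R].

Definition tensor n (x y : chain n) : chain2 n :=
  [ffun s : face n * face n => x s.1 * y s.2].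

(* d_U[n]: the indices in U are the vertices removed. *)
Definition dface n (U : {set 'I_n.+1}) : chain n := simplex (~: U).

(* rank U u is the 1-based index j with u = u_j, when U = {u_1 < u_2 < ...}. *)
Definition rank n (U : {set 'I_n.+1}) (u : 'I_n.+1) : nat :=
  #|[set v in U | (v <= u)%N]|.

Definition parity_part n (e : nat) (U : {set 'I_n.+1}) : {set 'I_n.+1} :=
  [set u in U | (u + rank U u == e %[mod 2])%N].

Definition canonical_cup (i n : nat) : chain2 n :=
  if (i <= n)%N then
    \sum_(U : {set 'I_n.+1} | #|U| == (n - i)%N)
      tensor (dface (parity_part 0 U)) (dface (parity_part 1 U))
  else 0.

(* The vertex set of [a, ..., b]; the join of faces is the union of vertex
   sets. *)
Definition block n (a b : nat) : {set 'I_n.+1} :=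
  [set v : 'I_n.+1 | (a <= v <= b)%N].

(* The term of index P = (p_1, ..., p_{i+1}); p j below is p_j, 1-based. *)
Definition steenrod_term (i n : nat) (P : (i.+1).-tuple 'I_n.+1) : chain2 n :=
  let p (j : nat) : nat := nth ord0 P j.-1 in
  if odd i then
    tensor
      (simplex (block n 0 (p 1%N)
                :|: (\bigcup_(1 <= k < (i.+1)./2) block n (p k.*2) (p k.*2.+1))
                :|: block n (p i.+1) n))
      (simplex (\bigcup_(0 <= k < (i.+1)./2) block n (p k.*2.+1) (p k.*2.+2)))
  else
    tensor
      (simplex (block n 0 (p 1%N)
                :|: (\bigcup_(1 <= k < (i./2).+1) block n (p k.*2) (p k.*2.+1))))
      (simplex ((\bigcup_(0 <= k < i./2) block n (p k.*2.+1) (p k.*2.+2))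
                :|: block n (p i.+1) n)).

Definition steenrod_cup (i n : nat) : chain2 n :=
  if (i <= n)%N then
    \sum_(P : (i.+1).-tuple 'I_n.+1 | sorted ltn [seq val v | v <- P])
      steenrod_term P
  else 0.

(* Main.v *)
(** For a sequence p_1 < ... < p_{i+1} let c(v), resp. c'(v), be the number of
    p_j smaller than v, resp. at most v.  For 0 <= j <= i+1 the j-th segment
    [p_j, ..., p_{j+1}] (with p_0 = 0 and p_{i+2} = n) consists of the v with
    c(v) <= j <= c'(v), where c' = c off the p_j and c' = c + 1 on them.  So v
    is missing from Steenrod's left (right) factor iff v is no p_j and c(v) is
    odd (even).  On the other hand, if U is the complement of
    {p_1, ..., p_{i+1}} and u = u_j in U, then j = u + 1 - c(u), so u + j has
    the parity of c(u) + 1.  The two sums therefore agree term by term. *)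
Require Import Defs.
From mathcomp Require Import all_boot all_algebra.
From mathcomp Require Import zify.

Set Implicit Arguments.
Unset Strict Implicit.
Unset Printing Implicit Defensive.

(** As [a] is closed downwards along [r], the entries satisfying it form an initial stretch of [s],
    whose length is the count. *)
Lemma nth_sorted_count (T : Type) (r : rel T) (a : pred T) (x0 : T)
    (s : seq T) (k : nat) :
  transitive r -> (forall x y, r x y -> a y -> a x) ->
  sorted r s -> k < size s -> a (nth x0 s k) = (k < count a s).
Proof.
move=> r_tr a_down; elim: s k => [|x s IHs] k //= xs_sorted.
have s_sorted := path_sorted xs_sorted.
have x_lt := order_path_min r_tr xs_sorted.
case ax: (a x); first by case: k => [|k] //= ks; rewrite IHs.
have s_a0 : count a s = 0.
  apply/eqP; rewrite eqn0Ngt -has_count -all_predC.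
  by apply: sub_all x_lt => y /a_down/contraFN; apply.
by case: k => [|k] /= ks; rewrite s_a0 ?ax // IHs // s_a0.
Qed.

Lemma in_bigcup_nat (T : finType) (F : nat -> {set T}) (m k : nat) (x : T) :
  reflect (exists2 j, m <= j < k & x \in F j)
          (x \in \bigcup_(m <= j < k) F j).
Proof.
have -> : x \in \bigcup_(m <= j < k) F j
          = has (fun j => x \in F j) (index_iota m k).
  elim: (index_iota m k) => [|j s IHs] /=; first by rewrite big_nil inE.
  by rewrite big_cons inE IHs.
apply: (iffP hasP) => -[j jmk xFj];
  by exists j; rewrite ?mem_index_iota // in jmk *.
Qed.

(** This is c(v); [le_count] below is c'(v). *)
Definition lt_count (n : nat) (s : seq 'I_n.+1) (v : 'I_n.+1) : nat :=
  count (fun x : 'I_n.+1 => x < v) s.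

Definition le_count (n : nat) (s : seq 'I_n.+1) (v : 'I_n.+1) : nat :=
  count (fun x : 'I_n.+1 => x <= v) s.

Lemma sorted_ltn_uniq (n : nat) (s : seq 'I_n.+1) :
  sorted ltn [seq val v | v <- s] -> uniq s.
Proof. by move/(sorted_uniq ltn_trans ltnn); apply: map_uniq. Qed.

Lemma le_countE (n : nat) (s : seq 'I_n.+1) (v : 'I_n.+1) :
  uniq s -> le_count s v = lt_count s v + (v \in s).
Proof.
move=> s_uniq; rewrite -count_uniq_mem // /le_count /lt_count.
elim: s {s_uniq} => //= x s ->.
rewrite -(inj_eq val_inj) leq_eqVlt; case: ltngtP; lia.
Qed.

(** The [u.+1] vertices up to [u] are split into those in [s] and those outside it. *)
Lemma le_count_rank (n : nat) (s : seq 'I_n.+1) (u : 'I_n.+1) :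
  uniq s -> le_count s u + rank (~: [set x in s]) u = u.+1.
Proof.
move=> s_uniq; rewrite /le_count /rank.
have <- : #|[set x : 'I_n.+1 | x <= u]| = u.+1.
  rewrite -sum1dep_card -(big_ord_widen n.+1 (fun=> 1) (ltn_ord u)).
  by rewrite sum1_card card_ord.
rewrite -(cardsID [set x in s]); congr (_ + _); last first.
  by apply: eq_card => x; rewrite !inE.
rewrite -size_filter -(card_uniqP (filter_uniq _ s_uniq)).
by apply: eq_card => x; rewrite !inE mem_filter.
Qed.

Lemma nth_ltE (n : nat) (s : seq 'I_n.+1) (v : 'I_n.+1) (k : nat) :
  sorted ltn [seq val v | v <- s] -> k < size s ->
  (nth ord0 s k < v) = (k < lt_count s v).
Proof.
rewrite sorted_map => s_sorted ks.
apply: (@nth_sorted_count _ (relpre val ltn) (fun x : 'I_n.+1 => x < v)) => //.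
  by move=> y x z /=; apply: ltn_trans.
by move=> x y /=; apply: ltn_trans.
Qed.

Lemma nth_leE (n : nat) (s : seq 'I_n.+1) (v : 'I_n.+1) (k : nat) :
  sorted ltn [seq val v | v <- s] -> k < size s ->
  (nth ord0 s k <= v) = (k < le_count s v).
Proof.
rewrite sorted_map => s_sorted ks.
apply: (@nth_sorted_count _ (relpre val ltn) (fun x : 'I_n.+1 => x <= v)) => //.
  by move=> y x z /=; apply: ltn_trans.
by move=> x y /= /ltnW; apply: leq_trans.
Qed.

(* The union of the segments with even ([b = false]), resp. odd ([b = true]),
   index. *)
Definition segments (n : nat) (b : bool) (s : seq 'I_n.+1) : {set 'I_n.+1} :=
  [set v | (odd (lt_count s v) == b) || (odd (le_count s v) == b)].

(** Without repetitions in [s] the two counts differ by at most one, so the only candidates for [j]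
    are the counts themselves. *)
Lemma segmentsP (n : nat) (b : bool) (s : seq 'I_n.+1) (v : 'I_n.+1) :
  uniq s ->
  reflect (exists2 j, odd j = b & lt_count s v <= j <= le_count s v)
          (v \in segments b s).
Proof.
move=> s_uniq; rewrite inE le_countE //; apply: (iffP orP).
  by case=> /eqP oj; [exists (lt_count s v) | exists (lt_count s v + (v \in s))];
     rewrite ?leqnn ?leq_addr.
case=> j <- lejl; have [->|->] : j = lt_count s v \/ j = lt_count s v + (v \in s).
- by case: (v \in s) lejl; lia.
- by left.
- by right.
Qed.

Lemma steenrod_termE (i n : nat) (P : (i.+1).-tuple 'I_n.+1) :
  sorted ltn [seq val v | v <- P] ->
  steenrod_term P
  = tensor (simplex (segments false P)) (simplex (segments true P)).
Proof.
move=> P_sorted; have P_uniq := sorted_ltn_uniq P_sorted.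
have szP := size_tuple P.
have ltP (v : 'I_n.+1) k : k <= i -> (nth ord0 P k < v) = (k < lt_count P v).
  by move=> ki; rewrite nth_ltE ?szP.
have leP (v : 'I_n.+1) k : k <= i -> (nth ord0 P k <= v) = (k < le_count P v).
  by move=> ki; rewrite nth_leE ?szP.
have le_max v : le_count P v <= i.+1 by rewrite -[leqRHS]szP count_size.
have lt_le v : lt_count P v <= le_count P v by rewrite le_countE ?leq_addr.
(* In the two extreme segments, of index 0 and [i.+1], one of the bounds on the index is automatic.
   Positions in [P] start at 0, so p_k is the entry at [k.-1]. *)
have first_in v : (v \in block n 0 (nth ord0 P 0)) = (lt_count P v == 0).
  by rewrite inE /= leqNgt ltP // -eqn0Ngt.
have last_in v : (v \in block n (nth ord0 P i) n) = (le_count P v == i.+1).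
  by rewrite inE /= leP // (ltn_ord v : v <= n) andbT eqn_leq le_max.
have mid_in v k : 0 < k <= i ->
    (v \in block n (nth ord0 P k.-1) (nth ord0 P k))
    = (lt_count P v <= k <= le_count P v).
  case: k => // k /= ki; rewrite inE (leP _ _ (ltnW ki)) [_ <= nat_of_ord _]leqNgt ltP //.
  by rewrite -leqNgt andbC.
(* The segment ending at [n] has index [i.+1], so it belongs to the left factor for odd [i] and to
   the right one for even [i]. *)
rewrite /steenrod_term; case: ifP => i_odd; congr tensor; congr simplex;
  apply/setP => v; apply/idP/segmentsP => //.
- rewrite !in_setU first_in last_in -orbA => /or3P[/eqP v0|/in_bigcup_nat[k kb]|/eqP vi].
  + by exists 0; rewrite // v0.
  + by rewrite mid_in; [exists k.*2; rewrite ?odd_double|lia].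
  + by exists i.+1; rewrite /= ?i_odd // (leq_trans (lt_le v) (le_max v)) vi leqnn.
- case=> j oj jv; rewrite !in_setU first_in last_in -orbA.
  have ji : j <= i.+1 by have := le_max v; lia.
  apply/or3P; case: (posnP j) => [j0|j_gt0]; first by constructor 1; lia.
  case: (eqVneq j i.+1) => [jE|j_neq].
    by constructor 3; rewrite eqn_leq le_max; case/andP: jv; rewrite jE.
  constructor 2; apply/in_bigcup_nat; exists j./2; first lia.
  by have -> : j./2.*2 = j by [lia]; rewrite mid_in ?jv //; lia.
- case/in_bigcup_nat=> k kb; rewrite mid_in => [kv|]; last lia.
  by exists k.*2.+1; rewrite //= odd_double.
- case=> j oj jv; apply/in_bigcup_nat.
  have ji : j <= i.+1 by have := le_max v; lia.
  exists j./2; first lia.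
  by have -> : j./2.*2.+1 = j by [lia]; rewrite mid_in ?jv //; lia.
- rewrite in_setU first_in => /orP[/eqP v0|/in_bigcup_nat[k kb]].
  + by exists 0; rewrite // v0.
  + by rewrite mid_in; [exists k.*2; rewrite ?odd_double|lia].
- case=> j oj jv; rewrite in_setU first_in.
  have ji : j <= i.+1 by have := le_max v; lia.
  case: (posnP j) => [j0|j_gt0]; first by apply/orP; left; lia.
  apply/orP; right; apply/in_bigcup_nat; exists j./2; first lia.
  by have -> : j./2.*2 = j by [lia]; rewrite mid_in ?jv //; lia.
- rewrite in_setU last_in => /orP[/in_bigcup_nat[k kb]|/eqP vi].
  + rewrite mid_in => [kv|]; last lia.
    by exists k.*2.+1; rewrite //= odd_double.
  + by exists i.+1; rewrite /= ?i_odd // (leq_trans (lt_le v) (le_max v)) vi leqnn.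
- case=> j oj jv; rewrite in_setU last_in.
  have ji : j <= i.+1 by have := le_max v; lia.
  case: (eqVneq j i.+1) => [jE|j_neq].
    by apply/orP; right; rewrite eqn_leq le_max; case/andP: jv; rewrite jE.
  apply/orP; left; apply/in_bigcup_nat; exists j./2; first lia.
  by have -> : j./2.*2.+1 = j by [lia]; rewrite mid_in ?jv //; lia.
Qed.

(** A vertex in [s] lies on both sides, its two counts being consecutive. For any other [u] the
    counts agree, and [u] plus its rank is [2u + 1] minus their value. *)
Lemma setC_parity_part (n e : nat) (s : seq 'I_n.+1) :
  uniq s -> e < 2 ->
  ~: parity_part e (~: [set x in s]) = segments (e == 1) s.
Proof.
move=> s_uniq e_lt2; apply/setP => u; rewrite !inE.
have := le_countE u s_uniq; have := le_count_rank u s_uniq.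
by case: (u \in s); lia.
Qed.

Lemma sorted_enum_set (n : nat) (A : {set 'I_n.+1}) :
  sorted ltn [seq val v | v <- enum A].
Proof.
rewrite sorted_map /enum_mem; apply: sorted_filter => [y x z|]; first exact: ltn_trans.
by rewrite -sorted_map -enumT val_enum_ord iota_ltn_sorted.
Qed.

Theorem mainTheorem3 (i n : nat) : steenrod_cup i n = canonical_cup i n.
Proof.
rewrite /steenrod_cup /canonical_cup; case: ifP => // le_in.
pose compl (P : (i.+1).-tuple 'I_n.+1) := ~: [set x in P].
(* The constant tuple is a default for sets [U] of the wrong size, which do not occur in the
   canonical sum. *)
pose points (U : {set 'I_n.+1}) : (i.+1).-tuple 'I_n.+1 :=
  insubd [tuple of nseq i.+1 ord0] (enum (~: U)).
have points_val (U : {set 'I_n.+1}) :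
    #|U| = n - i -> points U = enum (~: U) :> seq _.
  move=> cardU; rewrite val_insubd -cardE; have := cardsC U.
  rewrite cardU card_ord => cardCU; case: eqP => // -[].
  by apply: (@addnI (n - i)); rewrite cardCU addnS subnK.
have card_compl (P : (i.+1).-tuple 'I_n.+1) : uniq P -> #|compl P| = n - i.
  move=> P_uniq; have := cardsC [set x in P].
  rewrite cardsE card_ord (card_uniqP P_uniq) size_tuple => cardP.
  by apply: (@addnI i.+1); rewrite cardP addSn subnKC.
rewrite [RHS](reindex_onto compl points) /=; last first.
  move=> U /eqP cardU; apply/setP => x.
  by rewrite !inE memtE points_val // mem_enum inE negbK.
apply: eq_big => [P|P P_sorted].
  (* The increasing tuples are exactly those recovered from their complement: an increasing sequence
     is determined by its set of entries, and [points] lists vertices in increasing order. *)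
  apply/idP/andP => [P_sorted|[/eqP cardP /eqP <-]].
    have cardP := card_compl P (sorted_ltn_uniq P_sorted).
    split; first exact/eqP.
    apply/eqP/val_inj; rewrite /= points_val //.
    apply: (@irr_sorted_eq _ (relpre val ltn)).
    - by move=> y x z /=; apply: ltn_trans.
    - by move=> x /=; apply: ltnn.
    - by rewrite -sorted_map sorted_enum_set.
    - by rewrite -sorted_map.
    - by move=> x; rewrite mem_enum setCK inE.
  by rewrite points_val // sorted_enum_set.
have P_uniq := sorted_ltn_uniq P_sorted.
by rewrite steenrod_termE // /dface /compl !setC_parity_part.
Qed.
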